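(* Suppose Assumption 1 holds. For $\ell\in\{1,\dots,\mathsf{L}\}$ let $Y_\ell\in L_2(\mathsf{X}^2,\nu_\ell)$, set $g_\ell(\bm\theta)=Y_\ell(\bm\theta)-\int_{\mathsf{X}^2}Y_\ell\,\mathrm{d}\nu_\ell$, and let the Markov chain $(\bm\theta^n_\ell)_{n\ge0}$ with kernel $\bm p_\ell$ be started from a probability measure $\nu^0$ on $\mathsf{X}^2$ with $\nu^0\ll\nu_\ell$ and $\frac{\mathrm{d}\nu^0}{\mathrm{d}\nu_\ell}\in L_\infty(\mathsf{X}^2,\nu_\ell)$. For $N_\ell\in\mathbb{N}$, $n_{b,\ell}\in\mathbb{N}$ let $\hat Y_{\ell,N_\ell,n_{b,\ell}}=\frac1{N_\ell}\sum_{n=1}^{N_\ell}Y_\ell(\bm\theta_\ell^{n+n_{b,\ell}})$. Then $$\mathrm{MSE}(\hat Y_{\ell,N_\ell,n_{b,\ell}};\nu^0):=\mathsf{E}_{\nu^0,\bm P_\ell}\Big|\frac1{N_\ell}\sum_{n=1}^{N_\ell}g_\ell(\bm\theta_\ell^{n+n_{b,\ell}})\Big|^2\le C_{\mathrm{mse},\ell}\frac{\mathbb{V}_{\nu_\ell}[Y_\ell]}{N_\ell},$$ where $C_{\mathrm{mse},\ell}=C_{\mathrm{inv},\ell}+C_{\mathrm{ns},\ell}$ with $C_{\mathrm{inv},\ell}=1+\frac{4}{\gamma_{\mathrm{ps}}[\bm P_\ell]}$ and $C_{\mathrm{ns},\ell}=2\big\|\frac{\mathrm{d}\nu^0}{\mathrm{d}\nu_\ell}-1\big\|_{L_\infty}\big(1+\frac4{\gamma_{\mathrm{ps}}[\bm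 P_\ell]}\big)$.
   Context: Setting: $\mathsf{X}$ separable Banach space, prior $\mu_{\mathrm{pr}}$; posteriors $\mu^y_j$ with $\mu_{\mathrm{pr}}$-densities $\pi^y_j$; proposal density $Q_\ell$ w.r.t. $\mu_{\mathrm{pr}}$; $\alpha_j(\theta,z)=\min\{1,\frac{\pi^y_j(z)Q_\ell(\theta)}{\pi^y_j(\theta)Q_\ell(z)}\}$. Joint kernel for $\bm\theta_\ell=(\theta_{\ell,\ell-1},\theta_{\ell,\ell})$: $\bm p_\ell(\bm\theta_\ell,A)=\int\min\{\alpha_{\ell-1}(\theta_{\ell,\ell-1},z),\alpha_\ell(\theta_{\ell,\ell},z)\}\mathbf 1_{\{(z,z)\in A\}}Q_\ell(z)\mu_{\mathrm{pr}}(\mathrm{d}z)+\int(\alpha_{\ell-1}(\theta_{\ell,\ell-1},z)-\alpha_\ell(\theta_{\ell,\ell},z))^+\mathbf 1_{\{(z,\theta_{\ell,\ell})\in A\}}Q_\ell(z)\mu_{\mathrm{pr}}(\mathrm{d}z)+\int(\alpha_\ell(\theta_{\ell,\ell},z)-\alpha_{\ell-1}(\theta_{\ell,\ell-1},z))^+\mathbf 1_{\{(\theta_{\ell,\ell-1},z)\in A\}}Q_\ell(z)\mu_{\mathrm{pr}}(\mathrm{d}z)+\mathbf 1_{\{\bm\theta_\ell\in A\}}(1-\int\max\{\alpha_{\ell-1}(\theta_{\ell,\ell-1},z),\alpha_\ell(\theta_{\ell,\ell},z)\}Q_\ell(z)\mu_{\mathrm{pr}}(\mathrm{d}z))$, with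 operator $\bm P_\ell$ and unique invariant probability measure $\nu_\ell$ (under Assumption 1). $\mathsf{E}_{\nu^0,\bm P_\ell}$ is expectation over the chain with $\bm\theta^0_\ell\sim\nu^0$, $\bm\theta^n_\ell\sim\bm p_\ell(\bm\theta^{n-1}_\ell,\cdot)$; $\mathbb{V}_{\nu_\ell}$ is variance under $\nu_\ell$. Spectral quantities: $L_2^0=L_2^0(\mathsf{X}^2,\nu_\ell)$ is the subspace of $f\in L_2(\mathsf{X}^2,\nu_\ell)$ with $\int f\mathrm{d}\nu_\ell=0$; for a Markov operator $P$ on $L_2$, $\gamma_2[P]=1-\|P\|_{L_2^0\to L_2^0}$; $\bm P_\ell^*$ is the $L_2(\nu_\ell)$-adjoint of $\bm P_\ell$; the pseudo-spectral gap is $\gamma_{\mathrm{ps}}[\bm P_\ell]=\max_{k\ge1,k\in\mathbb{N}}\gamma_2[(\bm P_\ell^* )^k\bm P_\ell^k]/k$. Assumption 1: (1.1) $Q_\ell$ continuous and positive; (1.2) each $\pi^y_j$ continuous and positive; (1.3) for $j=\ell-1,\ell$, all $c_r>0$, $\{\theta: Q_\ell(\theta)/\pi^y_j(\theta)\le c_r\}$ compact; (1.4) $\exists c\in(0,1)$ independent of $\ell$ with $\operatorname{ess\,inf}_z Q_\ell(z)/\pi^y_j(z)\ge c$; (1.5) $\exists r>1,C_r$ independent of $\ell$ with $\int Q_\ell^r\mathrm{d}\mu_{\mathrm{pr}}\le C_r$. *)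

(* Defs.v *)
From HB Require Import structures.
From mathcomp Require Import all_boot all_order all_algebra.
From mathcomp Require Import all_classical all_reals all_analysis.
From mathcomp Require Import ess_sup_inf hoelder.
Set Implicit Arguments. Unset Strict Implicit. Unset Printing Implicit Defensive.
Import Order.TTheory GRing.Theory Num.Theory.
Import numFieldNormedType.Exports.
Local Open Scope classical_set_scope.
Local Open Scope ring_scope.

Definition borel {R : realType} (X : completeNormedModType R) :=
  g_sigma_algebraType (@open X).

Definition alpha {R : realType} {X : Type} (pi Q : X -> R) (t z : X) : R :=
  Num.min 1 ((pi z * Q t) / (pi t * Q z)).

(* The joint (coupled) kernel p_l(theta, A) of the paper, with
   pia = pi_{l-1}, pib = pi_l, and theta = (theta_{l,l-1}, theta_{l,l}). *)
Definition joint_kernel {R : realType} {X : completeNormedModType R}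
  (mupr : {measure set (borel X) -> \bar R}) (Q pia pib : X -> R)
  (t : (borel X * borel X)%type) (A : set (borel X * borel X)%type) : \bar R :=
  (\int[mupr]_z ((Num.min (alpha pia Q t.1 z) (alpha pib Q t.2 z))
                   * \1_A (z, z) * Q z)%:E
  + \int[mupr]_z ((Num.max 0 (alpha pia Q t.1 z - alpha pib Q t.2 z))
                   * \1_A (z, t.2) * Q z)%:E
  + \int[mupr]_z ((Num.max 0 (alpha pib Q t.2 z - alpha pia Q t.1 z))
                   * \1_A (t.1, z) * Q z)%:E
  + (\1_A t)%:E * (1 - \int[mupr]_z ((Num.max (alpha pia Q t.1 z)
                                       (alpha pib Q t.2 z)) * Q z)%:E))%E.

Section L2defs.
Context {d : measure_display} {T : measurableType d} {R : realType}.

Definition markov_op (p : T -> {measure set T -> \bar R}) (f : T -> R) : T -> R :=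
  fun t => Rintegral (p t) setT f.

Definition L2 (nu : {measure set T -> \bar R}) (f : T -> R) : Prop :=
  measurable_fun setT f /\ (\int[nu]_x ((f x) ^+ 2)%:E < +oo)%E.

Definition L20 (nu : {measure set T -> \bar R}) (f : T -> R) : Prop :=
  L2 nu f /\ (\int[nu]_x (f x)%:E = 0)%E.

Definition L2inner (nu : {measure set T -> \bar R}) (f g : T -> R) : R :=
  Rintegral nu setT (fun x => f x * g x).

Definition L2norm (nu : {measure set T -> \bar R}) (f : T -> R) : \bar R :=
  Lnorm nu 2%:E (EFin \o f).

Definition is_L2_adjoint (nu : {measure set T -> \bar R})
    (P A : (T -> R) -> (T -> R)) : Prop :=
  forall g, L2 nu g ->
    L2 nu (A g) /\ forall f, L2 nu f -> L2inner nu (P f) g = L2inner nu f (A g).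

Definition opnorm_L20 (nu : {measure set T -> \bar R})
    (B : (T -> R) -> (T -> R)) : \bar R :=
  ereal_sup ((fun f => L2norm nu (B f)) @`
               [set f : T -> R | L20 nu f /\ (L2norm nu f <= 1)%E]).

Definition gamma2 (nu : {measure set T -> \bar R}) (B : (T -> R) -> (T -> R))
  : \bar R := (1 - opnorm_L20 nu B)%E.

Definition pseudo_spectral_gap (nu : {measure set T -> \bar R})
    (P Pstar : (T -> R) -> (T -> R)) : \bar R :=
  ereal_sup ((fun k : nat =>
      (gamma2 nu (fun f => iter k Pstar (iter k P f)) * (k%:R^-1)%:E)%E)
      @` [set k : nat | (0 < k)%N]).

(* Integral over the first m transitions of a chain started at x:
   F receives the path w with w 0 = x, w 1, ..., w m the successive states
   (and w n = w m for n > m). *)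
Fixpoint chain_int (p : T -> {measure set T -> \bar R}) (m : nat)
    (F : (nat -> T) -> \bar R) (x : T) : \bar R :=
  match m with
  | 0 => F (fun _ => x)
  | m'.+1 => \int[p x]_y chain_int p m'
               (fun w => F (fun n => if n is n'.+1 then w n' else x)) y
  end.

Definition chain_expect (nu0 : {measure set T -> \bar R})
    (p : T -> {measure set T -> \bar R}) (m : nat) (F : (nat -> T) -> \bar R)
  : \bar R := \int[nu0]_x chain_int p m F x.

End L2defs.

(* 1 + 4/gamma, read as +oo when gamma = 0 *)
Definition Cinv {R : realType} (g : \bar R) : \bar R :=
  if ((0 < g) && (g < +oo))%E then (1 + 4 / fine g)%:E else +oo%E.

(* Main.v *)
Require Import Defs.
From HB Require Import structures.
From mathcomp Require Import all_boot all_order all_algebra.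
From mathcomp Require Import all_classical all_reals all_analysis.
From mathcomp Require Import ess_sup_inf hoelder.
From mathcomp Require Import measurable_realfun.
From mathcomp Require Import ring lra.
Import Order.TTheory GRing.Theory Num.Theory.
Import numFieldNormedType.Exports.
Local Open Scope classical_set_scope.
Local Open Scope ring_scope.

(** Let P be the transition operator, g the centred observable and h the initial
density.  Positivity of squares gives E_nu0 <= (1 + ||h - 1||_oo) E_nu, so it suffices
to bound the stationary error, whose second moment expands into the correlations
<P^m g, g>.  For every k one has
||P^k f||^2 = <f, (P^* )^k P^k f> <= rho_k ||f||^2 with rho_k = 1 - gamma_2, hence
|<P^m g, g>| <= rho_k^(floor(m / k) / 2) ||g||^2, and summing over m gives at most
k / (1 - sqrt rho_k) <= 2 k / gamma_2.  Since P^* is only determined up to null sets and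
P is only linear almost everywhere, linearity is always obtained by moving the operators
across the inner product. *)

Set Implicit Arguments.
Unset Strict Implicit.
Unset Printing Implicit Defensive.

(** * Comparison of integrals under measures dominated by one another *)

Section measure_domination.
Local Open Scope ereal_scope.
Context d (T : measurableType d) (R : realType).
Import HBNNSimple.

Lemma ge0_integral_le_measure (m1 m2 : {measure set T -> \bar R}) (k : R)
    (f : T -> \bar R) : (0 <= k)%R ->
  (forall A, measurable A -> m1 A <= k%:E * m2 A) ->
  (forall x, 0 <= f x) ->
  \int[m1]_x f x <= k%:E * \int[m2]_x f x.
Proof.
move=> k0 m12 f0; rewrite !ge0_integralTE//.
(* The nonnegative integral is a supremum over simple functions below [f], so setwise domination is
   applied level set by level set, without measurability of [f]. *)
apply: ge_ereal_sup => _ [h /= hf <-].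
apply: (@le_trans _ _ (k%:E * sintegral m2 h)); last first.
  by apply: lee_wpmul2l => //; apply: ereal_sup_ubound; exists h.
rewrite !sintegralE.
rewrite ge0_mule_fsumr; last by move=> r; exact: nnsfun_mulemu_ge0.
apply: lee_fsum => // r rh.
rewrite muleCA; apply: lee_wpmul2l; last exact: m12.
by case: rh => x _ <-; rewrite lee_fin.
Qed.

End measure_domination.

(** * Square-integrable functions, their inner product and Cauchy-Schwarz *)

Section square_integrable.
Context d (T : measurableType d) (R : realType).
Implicit Types f g : T -> R.

Lemma EFin_Rintegral (mu : {measure set T -> \bar R}) f :
  mu.-integrable setT (EFin \o f) ->
  ((\int[mu]_x f x)%R%:E = \int[mu]_x (f x)%:E)%E.
Proof. by move=> fi; rewrite fineK//; exact: integrable_fin_num. Qed.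

Variable mu : {measure set T -> \bar R}.

Lemma L2_measurable f : L2 mu f -> measurable_fun setT f.
Proof. by case. Qed.

Lemma L2_integrable_sqr f :
  L2 mu f -> mu.-integrable setT (EFin \o (fun x => f x ^+ 2)).
Proof.
move=> [mf fi]; apply/integrableP; split.
  by apply/measurable_EFinP; exact: measurable_funX.
apply: le_lt_trans fi; apply: ge0_le_integral => //.
- by apply: measurableT_comp => //; apply/measurable_EFinP; exact: measurable_funX.
- by apply/measurable_EFinP; exact: measurable_funX.
- by move=> x _ /=; rewrite lee_fin ger0_norm// sqr_ge0.
Qed.

Lemma L2_integrableM f g :
  L2 mu f -> L2 mu g -> mu.-integrable setT (EFin \o (fun x => f x * g x)).
Proof.
move=> Lf Lg.
have fg := integrableD measurableT (L2_integrable_sqr Lf) (L2_integrable_sqr Lg).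
apply: le_integrable fg => //.
  by apply/measurable_EFinP; apply: measurable_funM; [case: Lf|case: Lg].
move=> x _ /=; rewrite lee_fin normrM (ger0_norm (addr_ge0 (sqr_ge0 _) (sqr_ge0 _))).
by rewrite -(real_normK (num_real (f x))) -(real_normK (num_real (g x))); nra.
Qed.

Lemma L2_add f g : L2 mu f -> L2 mu g -> L2 mu (fun x => f x + g x).
Proof.
move=> Lf Lg; split; first by apply: measurable_funD; [case: Lf|case: Lg].
have fg := integrableD measurableT (L2_integrable_sqr Lf) (L2_integrable_sqr Lg).
apply: le_lt_trans (integrable_lty measurableT (integrableZl measurableT 2 fg)).
apply: ge0_le_integral => //.
- by move=> x _; rewrite lee_fin sqr_ge0.
- apply/measurable_EFinP; apply: measurable_funX.
  by apply: measurable_funD; [case: Lf|case: Lg].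
- by apply: measurable_funeM; case/integrableP: fg.
- by move=> x _ /=; rewrite lee_fin; have := sqr_ge0 (f x - g x); lra.
Qed.

Lemma L2_scale a f : L2 mu f -> L2 mu (fun x => a * f x).
Proof.
move=> Lf; split; first by apply: measurable_funM => //; case: Lf.
apply: le_lt_trans (integrable_lty measurableT
  (integrableZl measurableT (a ^+ 2) (L2_integrable_sqr Lf))).
by rewrite le_eqVlt; apply/orP; left; apply/eqP; apply: eq_integral => x _ /=;
  rewrite exprMn EFinM.
Qed.

Lemma L2innerC f g : L2inner mu f g = L2inner mu g f.
Proof. by apply: eq_Rintegral => x _; rewrite mulrC. Qed.

Lemma L2innerDl f1 f2 g : L2 mu f1 -> L2 mu f2 -> L2 mu g ->
  L2inner mu (fun x => f1 x + f2 x) g = L2inner mu f1 g + L2inner mu f2 g.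
Proof.
move=> L1 L2 Lg; rewrite /L2inner -RintegralD//; try exact: L2_integrableM.
by apply: eq_Rintegral => x _; rewrite mulrDl.
Qed.

Lemma L2innerZl a f g : L2 mu f -> L2 mu g ->
  L2inner mu (fun x => a * f x) g = a * L2inner mu f g.
Proof.
move=> Lf Lg; rewrite /L2inner -RintegralZl//; try exact: L2_integrableM.
by apply: eq_Rintegral => x _; rewrite mulrA.
Qed.

Lemma L2inner_ge0 f : 0 <= L2inner mu f f.
Proof. by apply: Rintegral_ge0 => x _; rewrite -expr2 sqr_ge0. Qed.

Lemma L2inner_cauchy_schwarz f g : L2 mu f -> L2 mu g ->
  L2inner mu f g ^+ 2 <= L2inner mu f f * L2inner mu g g.
Proof.
move=> Lf Lg.
(* Expansion of the squared norm of [f + s g]; the inequality is the discriminant condition for this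
   polynomial in [s]. *)
have quad s : 0 <= L2inner mu f f + 2 * s * L2inner mu f g + s ^+ 2 * L2inner mu g g.
  have Lsg := L2_scale s Lg.
  have := L2inner_ge0 (fun x => f x + s * g x).
  rewrite L2innerDl//; last exact: L2_add.
  rewrite (L2innerC f) (L2innerC (fun x => s * g x)) !L2innerDl//.
  rewrite (L2innerC f (fun x => s * g x)) !L2innerZl// (L2innerC g (fun x => s * g x)).
  rewrite !L2innerZl// (L2innerC g f).
  by congr (_ <= _); ring.
have B0 := L2inner_ge0 g.
move: (L2inner mu f f) (L2inner mu f g) (L2inner mu g g) quad B0 => A C B quad.
rewrite le_eqVlt => /orP[/eqP B0|B0].
  (* For [B = 0] the polynomial is affine in [s]; if [C] were nonzero, the chosen [s] would give it
     the value -1. *)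
  have [->|C0] := eqVneq C 0; first by rewrite -B0 expr0n mulr0.
  have := quad (- (A + 1) / (2 * C)).
  have -> : A + 2 * (- (A + 1) / (2 * C)) * C + (- (A + 1) / (2 * C)) ^+ 2 * B = -1.
    by rewrite -B0; field.
  by rewrite ler0N1.
(* The minimiser of the quadratic when [B] is positive. *)
have := quad (- C / B); rewrite -(pmulr_lge0 _ B0).
have -> : (A + 2 * (- C / B) * C + (- C / B) ^+ 2 * B) * B = A * B - C ^+ 2.
  by field; rewrite gt_eqF.
by rewrite subr_ge0.
Qed.

Lemma L2norm_sqr f : L2 mu f -> (L2norm mu f = (Num.sqrt (L2inner mu f f))%:E)%E.
Proof.
move=> Lf; rewrite /L2norm unlock.
rewrite (_ : (\int[mu]_x _)%E = (L2inner mu f f)%:E); last first.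
  rewrite EFin_Rintegral; last exact: L2_integrableM.
  apply: eq_integral => x _ /=.
  by rewrite powR_mulrn// real_normK ?num_real// expr2.
by rewrite poweR_EFin powR12_sqrt// L2inner_ge0.
Qed.

End square_integrable.

(** * Constants and centring under a probability measure *)

Section L2_finite_measure.
Context d (T : measurableType d) (R : realType) (mu : probability T R).

Lemma L2_cst c : L2 mu (fun=> c).
Proof.
split; first exact: measurable_cst.
rewrite (eq_integral (cst (c ^+ 2)%:E))// integral_cst//.
by rewrite [X in (_ * X)%E](@probability_setT _ _ _ mu) mule1 ltry.
Qed.

Lemma L2_integrable f : L2 mu f -> mu.-integrable setT (EFin \o f).
Proof.
move=> Lf; have := L2_integrableM Lf (L2_cst 1).
by apply: eq_integrable => // x _ /=; rewrite mulr1.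
Qed.

Lemma L20_center f : L2 mu f -> L20 mu (fun t => f t - \int[mu]_x f x).
Proof.
move=> Lf; set c := Rintegral _ _ _.
have Lc : L2 mu (fun t => f t - c) := L2_add Lf (L2_cst (- c)).
split => //; rewrite -EFin_Rintegral; last exact: L2_integrable.
rewrite RintegralB//; [|exact: L2_integrable|exact: (L2_integrable (L2_cst c))].
by rewrite Rintegral_cst// [X in _ - _ * fine X](@probability_setT _ _ _ mu) mulr1 subrr.
Qed.

End L2_finite_measure.

(** * The transition operator of a kernel with an invariant measure *)

Section invariant_kernel.
Context d (T : measurableType d) (R : realType).
Variables (nu : probability T R) (p : R.-pker T ~> T).
Hypothesis inv : forall A, measurable A -> (\int[nu]_t p t A = nu A)%E.
Local Notation P := (markov_op p).

(** Viewing [nu] as a constant kernel, the iterated integral is an integral against its composition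
    with [p]; by [inv] this composite measure agrees with [nu] on measurable sets. *)
Lemma ge0_integral_invariant (f : T -> \bar R) :
  (forall x, 0 <= f x)%E -> measurable_fun setT f ->
  (\int[nu]_x \int[p x]_y f y = \int[nu]_x f x)%E.
Proof.
move=> f0 mf.
pose l := kprobability (@measurable_cst _ _ T _ setT (nu : pprobability T R)).
have := @integral_kcomp _ _ _ _ _ _ R l (kernel.kernel_snd p) point f f0 mf.
move=> /= <-.
by apply: eq_measure_integral => A mA _; exact: inv.
Qed.

(** For a [nu]-null set, [p x] of that set has [nu]-integral zero by invariance, hence vanishes for
    almost every [x]. *)
Lemma ae_invariant (Q : T -> Prop) :
  {ae nu, forall x, Q x} -> {ae nu, forall x, {ae p x, forall y, Q y}}.
Proof.
move=> [A [mA A0 QA]].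
have pA : ae_eq nu setT (p ^~ A) (cst 0).
  apply/ae_eq_integral_abs => //; first exact: measurable_kernel.
  by under eq_integral do rewrite gee0_abs//; rewrite inv.
apply: filterS pA => x /(_ Logic.I) pxA.
by exists A.
Qed.

Lemma measurable_integral_kernel (f : T -> R) :
  measurable_fun setT f -> measurable_fun setT (fun x => \int[p x]_y (f y)%:E)%E.
Proof.
move=> mf; have mf' : measurable_fun setT (EFin \o f) by exact/measurable_EFinP.
under eq_fun do rewrite integralE.
apply: emeasurable_funB; apply: measurable_fun_integral_kernel => //.
- exact: measurable_kernel.
- exact: measurable_funepos.
- exact: measurable_kernel.
- exact: measurable_funeneg.
Qed.

Lemma measurable_markov_op (f : T -> R) :
  measurable_fun setT f -> measurable_fun setT (P f).
Proof.
by move=> mf; apply: measurableT_comp (measurable_integral_kernel mf).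
Qed.

(** The integral of [|f|] under [p x] has, as a function of [x], the same finite [nu]-integral as
    [|f|], so it is finite almost everywhere. *)
Lemma integrable_kernel (f : T -> R) : nu.-integrable setT (EFin \o f) ->
  {ae nu, forall x, (p x).-integrable setT (EFin \o f)}.
Proof.
move=> /integrableP[mf fi].
have mf' := mf; move/measurable_EFinP : mf' => mf'.
have ifi : nu.-integrable setT (fun x => \int[p x]_y `|(f y)%:E|)%E.
  apply/integrableP; split.
    apply: measurable_fun_integral_kernel => //.
    - exact: measurable_kernel.
    - exact: measurableT_comp.
  under eq_integral do rewrite gee0_abs ?integral_ge0//.
  by rewrite ge0_integral_invariant//; exact: measurableT_comp.
apply: filterS (integrable_ae measurableT ifi) => x /(_ Logic.I) xfin.
by apply/integrableP; split => //; rewrite ltey_eq xfin.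
Qed.

(** [markov_op] applies [fine], which sends infinite values to 0; the identity is therefore claimed
    only where [f] is integrable under [p x]. *)
Lemma markov_op_EFin (f : T -> R) : nu.-integrable setT (EFin \o f) ->
  {ae nu, forall x, (P f x)%:E = \int[p x]_y (f y)%:E}%E.
Proof.
by move=> /integrable_kernel; apply: filterS => x fi; exact: EFin_Rintegral.
Qed.

(** Invariance is applied to the positive and negative parts separately; integrability of both
    allows the subtraction. *)
Lemma integral_markov_op (f : T -> R) : nu.-integrable setT (EFin \o f) ->
  nu.-integrable setT (EFin \o P f) /\
  (\int[nu]_x (P f x)%:E = \int[nu]_x (f x)%:E)%E.
Proof.
move=> fi; have /integrableP[mf fiy] := fi.
have mf' := mf; move/measurable_EFinP : mf' => mf'.
have mP := measurable_markov_op mf'; have mPE : measurable_fun setT (EFin \o P f).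
  exact/measurable_EFinP.
have Pi : nu.-integrable setT (EFin \o P f).
  apply/integrableP; split => //; apply: le_lt_trans fiy.
  rewrite -[leRHS]ge0_integral_invariant//; last exact: measurableT_comp.
  apply: ae_ge0_le_integral => //.
  - exact: measurableT_comp.
  - by move=> x _; exact: integral_ge0.
  - apply: measurable_fun_integral_kernel => //.
    + exact: measurable_kernel.
    + exact: measurableT_comp.
  - apply: filterS (markov_op_EFin fi) => x Px _.
    by rewrite [(EFin \o P f) x]Px; exact: le_abse_integral.
split => //.
have fpi := integrable_funepos measurableT fi.
have fni := integrable_funeneg measurableT fi.
have mpos : measurable_fun setT (fun x => \int[p x]_y (EFin \o f)^\+ y)%E.
  apply: measurable_fun_integral_kernel => //; first exact: measurable_kernel.
  exact: measurable_funepos.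
have mneg : measurable_fun setT (fun x => \int[p x]_y (EFin \o f)^\- y)%E.
  apply: measurable_fun_integral_kernel => //; first exact: measurable_kernel.
  exact: measurable_funeneg.
have ipos : nu.-integrable setT (fun x => \int[p x]_y (EFin \o f)^\+ y)%E.
  apply/integrableP; split => //.
  under eq_integral do rewrite gee0_abs ?integral_ge0//.
  rewrite ge0_integral_invariant//; last exact: measurable_funepos.
  exact: (integrable_lty measurableT fpi).
have ineg : nu.-integrable setT (fun x => \int[p x]_y (EFin \o f)^\- y)%E.
  apply/integrableP; split => //.
  under eq_integral do rewrite gee0_abs ?integral_ge0//.
  rewrite ge0_integral_invariant//; last exact: measurable_funeneg.
  exact: (integrable_lty measurableT fni).
rewrite [RHS]integralE -[X in _ = (X - _)%E]ge0_integral_invariant//; last first.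
  exact: measurable_funepos.
rewrite -[X in _ = (_ - X)%E]ge0_integral_invariant//; last exact: measurable_funeneg.
rewrite -integralB//; apply: ae_eq_integral => //.
  exact: emeasurable_funB.
apply: filterS (markov_op_EFin fi) => x Px _.
by rewrite [LHS]Px integralE.
Qed.

(** Jensen's inequality for the square, read off from the nonnegative variance of [f] under
    [p x]. *)
Lemma markov_op_sqr_le (f : T -> R) : L2 nu f ->
  {ae nu, forall x, (P f x) ^+ 2 <= P (fun y => f y ^+ 2) x}.
Proof.
move=> Lf.
near=> x.
have fi : (p x).-integrable setT (EFin \o f).
  by near: x; exact: (integrable_kernel (L2_integrable Lf)).
have f2i : (p x).-integrable setT (EFin \o (fun y => f y ^+ 2)).
  by near: x; exact: (integrable_kernel (L2_integrable_sqr Lf)).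
have ci c : (p x).-integrable setT (EFin \o cst c).
  apply/integrableP; split; first exact/measurable_EFinP.
  rewrite (eq_integral (cst `|c|%:E))// integral_cst//.
  by rewrite [X in (_ * X)%E]prob_kernel mule1 ltry.
set c := P f x.
have : 0 <= \int[p x]_y (f y - c) ^+ 2.
  by apply: Rintegral_ge0 => y _; rewrite sqr_ge0.
have fci : (p x).-integrable setT (EFin \o (fun y => f y * (2 * c))).
  have := integrableZr measurableT (2 * c) fi.
  by apply: eq_integrable.
rewrite (@eq_Rintegral _ _ _ _ _ (fun y => (f y ^+ 2 - f y * (2 * c)) + c ^+ 2)); last first.
  by move=> y _; ring.
rewrite RintegralD//; last 2 first.
- by have := integrableB measurableT f2i fci; apply: eq_integrable.
- exact: ci.
rewrite RintegralB// RintegralZr// Rintegral_cst//.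
rewrite -/(P f x) -/c -/(P _ x) prob_kernel/=.
by lra.
Unshelve. all: by end_near. Qed.

Lemma L2_markov_op (f : T -> R) : L2 nu f ->
  L2 nu (P f) /\ L2inner nu (P f) (P f) <= L2inner nu f f.
Proof.
move=> Lf; have f2i := L2_integrable_sqr Lf.
have [Pi PE] := integral_markov_op f2i.
have mP := measurable_markov_op (L2_measurable Lf).
have le : (\int[nu]_x ((P f x) ^+ 2)%:E <= \int[nu]_x (f x ^+ 2)%:E)%E.
  rewrite -PE; apply: ae_ge0_le_integral => //.
  - by move=> x _; rewrite lee_fin sqr_ge0.
  - by apply/measurable_EFinP; exact: measurable_funX.
  - by move=> x _; rewrite lee_fin; apply: Rintegral_ge0 => y _; rewrite sqr_ge0.
  - by case/integrableP: Pi.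
  - by apply: filterS (markov_op_sqr_le Lf) => x ? _; rewrite lee_fin.
have LP : L2 nu (P f) by split => //; apply: le_lt_trans le _; case: Lf.
split => //.
rewrite -lee_fin !EFin_Rintegral; try exact: L2_integrableM.
by under eq_integral do rewrite -expr2; under [leRHS]eq_integral do rewrite -expr2.
Qed.

Lemma L2_iter_markov_op k (f : T -> R) : L2 nu f ->
  L2 nu (iter k P f) /\ L2inner nu (iter k P f) (iter k P f) <= L2inner nu f f.
Proof.
move=> Lf; elim: k => // k [L le]; have [L' le'] := L2_markov_op L.
by split => //=; exact: le_trans le' le.
Qed.

Lemma L20_iter_markov_op k (f : T -> R) : L20 nu f -> L20 nu (iter k P f).
Proof.
move=> [Lf f0]; split; first by case: (L2_iter_markov_op k Lf).
elim: k => //= k IH; have [L _] := L2_iter_markov_op k Lf.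
by rewrite (integral_markov_op (L2_integrable L)).2.
Qed.

End invariant_kernel.

(** * Decay of correlations from the pseudo-spectral gap *)

Lemma sum_expr_divn (R : realFieldType) (s : R) (k M : nat) : (0 < k)%N ->
  0 <= s < 1 -> \sum_(m < M) s ^+ (m %/ k) <= k%:R / (1 - s).
Proof.
move=> k0 /andP[s0 s1].
(* The exponent [m %/ k] is constant on blocks of length [k], so a sum over whole blocks is [k]
   times a geometric sum; [M] is later enlarged to [M * k]. *)
have block q : \sum_(m < q * k) s ^+ (m %/ k) = k%:R * \sum_(j < q) s ^+ j.
  elim: q => [|q IH]; first by rewrite mul0n !big_ord0 mulr0.
  rewrite big_ord_recr/= mulrDr -IH -!(big_mkord xpredT (fun m => s ^+ (m %/ k))).
  rewrite (@big_cat_nat _ _ _ (q * k)) ?leq_mul//=; congr (_ + _).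
  rewrite -{1}[(q * k)%N]add0n big_addn mulSn addnK.
  rewrite (eq_big_nat _ _ (F2 := fun=> s ^+ q)); last first.
    by move=> i /andP[_ ik]; rewrite addnC divnMDl// divn_small// addn0.
  by rewrite big_const_nat subn0 iter_addr_0 mulr_natl.
have Mk : (M <= M * k)%N by rewrite leq_pmulr.
apply: (@le_trans _ _ (\sum_(m < M * k) s ^+ (m %/ k))).
  rewrite -!(big_mkord xpredT (fun m => s ^+ (m %/ k))).
  rewrite [leRHS](@big_cat_nat _ _ _ M)//= lerDl.
  by apply: sumr_ge0 => i _; rewrite exprn_ge0.
rewrite block ler_wpM2l// -[leRHS]mul1r ler_pdivlMr ?subr_gt0//.
have -> : (\sum_(j < M) s ^+ j) * (1 - s) = 1 - s ^+ M.
  by rewrite mulrC -[1 in RHS](expr1n _ M) subrXX; congr (_ * _);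
    apply: eq_bigr => i _; rewrite expr1n mul1r.
by rewrite lerBlDr lerDl exprn_ge0.
Qed.

Section pseudo_spectral_gap.
Context d (T : measurableType d) (R : realType).
Variables (nu : probability T R) (p : R.-pker T ~> T).
Hypothesis inv : forall B, measurable B -> (\int[nu]_t p t B = nu B)%E.
Local Notation P := (markov_op p).
Variable A : (T -> R) -> (T -> R).
Hypothesis adjA : is_L2_adjoint nu P A.

Lemma L2_iter_adjoint k g : L2 nu g -> L2 nu (iter k A g).
Proof. by move=> Lg; elim: k => //= k /adjA[]. Qed.

Lemma iter_adjoint k f g : L2 nu f -> L2 nu g ->
  L2inner nu (iter k P f) g = L2inner nu f (iter k A g).
Proof.
move=> Lf; elim: k g => // k IH g Lg.
have [LAg adj] := adjA Lg.
by rewrite [iter k.+1 A g]iterSr -IH// iterS adj//; case: (L2_iter_markov_op inv k Lf).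
Qed.

(** The scalar leaves one slot at a time: each time the operators are moved to the other slot by
    adjointness, and the inner product is homogeneous. *)
Lemma L2inner_iterZ k c f : L2 nu f ->
  L2inner nu (iter k P (fun x => c * f x)) (iter k P (fun x => c * f x)) =
  c ^+ 2 * L2inner nu (iter k P f) (iter k P f).
Proof.
move=> Lf; have Lcf := L2_scale c Lf.
have [LP _] := L2_iter_markov_op inv k Lf.
have [LPc _] := L2_iter_markov_op inv k Lcf.
rewrite iter_adjoint// L2innerZl//; last exact: L2_iter_adjoint.
rewrite -iter_adjoint// L2innerC iter_adjoint// L2innerZl//; last exact: L2_iter_adjoint.
by rewrite -iter_adjoint// mulrA.
Qed.

(** For a unit vector [f'], adjointness and Cauchy-Schwarz bound the squared norm of [P^k f'] by the
    norm of [A^k P^k f'], hence by [rho]. Scaling gives the general case. *)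
Lemma opnorm_contraction k (rho : R) f :
  (opnorm_L20 nu (fun f => iter k A (iter k P f)) <= rho%:E)%E -> L20 nu f ->
  L2inner nu (iter k P f) (iter k P f) <= rho * L2inner nu f f.
Proof.
move=> hrho [Lf f0].
have [LP le] := L2_iter_markov_op inv k Lf.
(* A function of norm zero cannot be normalised; there, contractivity of [P] suffices. *)
have := L2inner_ge0 nu f; rewrite le_eqVlt => /orP[/eqP s0|s0].
  by move: le; rewrite -s0 mulr0.
set s := L2inner nu f f in s0 *.
pose c := (Num.sqrt s)^-1.
have c2 : c ^+ 2 * s = 1.
  by rewrite /c exprVn sqr_sqrtr ?ltW// mulVf// gt_eqF.
pose f' := fun x => c * f x.
have Lf' : L2 nu f' by exact: L2_scale.
have ff' : L2inner nu f' f' = 1.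
  by rewrite /f' L2innerZl// L2innerC L2innerZl// mulrA -expr2.
have [LP' _] := L2_iter_markov_op inv k Lf'.
have LB : L2 nu (iter k A (iter k P f')) by exact: L2_iter_adjoint.
have : (L2norm nu (iter k A (iter k P f')) <= rho%:E)%E.
  apply: le_trans hrho; apply: ereal_sup_ubound; exists f' => //; split.
    split => //; rewrite /f'; under eq_integral do rewrite EFinM.
    rewrite integralZl//; last exact: L2_integrable.
    by rewrite f0 mule0.
  by rewrite L2norm_sqr// ff' sqrtr1.
rewrite L2norm_sqr// lee_fin => Brho.
have PB : L2inner nu (iter k P f') (iter k P f') <= rho.
  rewrite iter_adjoint//; apply: le_trans Brho.
  apply: (le_trans (ler_norm _)); rewrite -sqrtr_sqr ler_sqrt ?L2inner_ge0//.
  by have := L2inner_cauchy_schwarz Lf' LB; rewrite ff' mul1r.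
move: PB; rewrite L2inner_iterZ// => PB.
have := ler_wpM2r (ltW s0) PB.
by rewrite mulrAC c2 mul1r.
Qed.

(** Each full block of [k] steps gains a factor [rho]; for the [m %% k] remaining steps it is enough
    that [P] does not increase the norm. *)
Lemma iter_contraction k (rho : R) m f : (0 < k)%N -> 0 <= rho ->
  (opnorm_L20 nu (fun f => iter k A (iter k P f)) <= rho%:E)%E -> L20 nu f ->
  L2inner nu (iter m P f) (iter m P f) <= rho ^+ (m %/ k) * L2inner nu f f.
Proof.
move=> k0 rho0 hrho Lf.
have mul q : L2inner nu (iter (q * k) P f) (iter (q * k) P f) <= rho ^+ q * L2inner nu f f.
  elim: q => [|q IH]; first by rewrite mul0n expr0 mul1r.
  rewrite mulSn iterD exprS -mulrA.
  apply: (le_trans (opnorm_contraction hrho (L20_iter_markov_op inv _ Lf))).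
  exact: ler_wpM2l.
rewrite {1 2}(divn_eq m k) addnC iterD.
apply: le_trans (mul _).
by have [] := L2_iter_markov_op inv (m %% k) (L20_iter_markov_op inv (m %/ k * k) Lf).1.
Qed.

Lemma sum_correlation_le (gamma : R) M f : 0 < gamma ->
  (gamma%:E < pseudo_spectral_gap nu P A)%E -> L20 nu f ->
  \sum_(m < M) `|L2inner nu (iter m P f) f| <= 2 / gamma * L2inner nu f f.
Proof.
move=> g0 /ereal_sup_gt[_ [k /= k0 <-]] gk Lf.
set B := fun f => iter k A (iter k P f) in gk *.
(* Testing the zero function excludes the value -oo for the norm. *)
have op0 : (0 <= opnorm_L20 nu B)%E.
  apply: (@le_trans _ _ (L2norm nu (B (fun=> 0)))); first exact: Lnorm_ge0.
  apply: ereal_sup_ubound; exists (fun=> 0) => //; split.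
    by split; [exact: L2_cst|rewrite integral0].
  rewrite L2norm_sqr; last exact: L2_cst.
  rewrite (_ : L2inner nu _ _ = 0) ?sqrtr0 ?lee_fin//.
  by rewrite /L2inner; under eq_Rintegral do rewrite mulr0; rewrite /Rintegral integral0.
have kR : 0 < k%:R :> R by rewrite ltr0n.
move: gk; rewrite /gamma2.
(* A norm equal to +oo would make [gamma2] equal to -oo, contradicting [gk]. *)
case E : (opnorm_L20 nu B) op0 => [rho| |//] rho0; last first.
  by rewrite mulNyr gtr0_sg ?invr_gt0// mul1e.
rewrite lee_fin in rho0.
rewrite -EFinB -EFinM lte_fin ltr_pdivlMr// => gk.
have gk0 : 0 < gamma * k%:R by exact: mulr_gt0.
(* [rho] controls squared norms, whereas correlations decay like the norm itself, hence the square
   root. *)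
pose s := Num.sqrt rho.
have s0 : 0 <= s by exact: sqrtr_ge0.
have s2 : s ^+ 2 = rho by rewrite sqr_sqrtr.
have s1 : s < 1 by nra.
have S0 := L2inner_ge0 nu f.
have cor m : `|L2inner nu (iter m P f) f| <= s ^+ (m %/ k) * L2inner nu f f.
  have [LP _] := L20_iter_markov_op inv m Lf.
  rewrite -ler_sqr ?nnegrE ?mulr_ge0 ?exprn_ge0// real_normK ?num_real//.
  apply: (le_trans (L2inner_cauchy_schwarz LP Lf.1)).
  rewrite exprMn exprAC s2 expr2 mulrA ler_wpM2r//.
  by apply: iter_contraction => //; rewrite -E.
apply: (@le_trans _ _ (\sum_(m < M) s ^+ (m %/ k) * L2inner nu f f)).
  by apply: ler_sum => m _; exact: cor.
rewrite -mulr_suml ler_wpM2r//.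
apply: (le_trans (sum_expr_divn M k0 _)); first by rewrite s0.
(* The claim becomes [k * gamma <= 2 * (1 - s)], which follows from
   [gamma * k < 1 - s^2 = (1 - s) (1 + s)] and [s < 1]. *)
rewrite ler_pdivrMr ?subr_gt0// mulrAC ler_pdivlMr//.
by nra.
Qed.

End pseudo_spectral_gap.

(** * Second moment of weighted sums along the chain *)

Section chain_second_moment.
Context d (T : measurableType d) (R : realType).
Variables (nu : probability T R) (p : R.-pker T ~> T).
Hypothesis inv : forall B, measurable B -> (\int[nu]_t p t B = nu B)%E.
Local Notation P := (markov_op p).
Variable g : T -> R.
Hypothesis Lg : L2 nu g.

(** The accumulator [a] holds the contribution of states already visited, so that one transition
    only updates [a] and shifts the weights [c]. *)
Definition chain_sq m (a : R) (c : nat -> R) : T -> \bar R :=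
  chain_int p m (fun w => ((a + \sum_(i < m.+1) c i * g (w i)) ^+ 2)%:E).

Lemma chain_sqS m a c x :
  chain_sq m.+1 a c x = (\int[p x]_y chain_sq m (a + c 0%N * g x) (c \o S) y)%E.
Proof.
rewrite /chain_sq /=; apply: eq_integral => y _; congr (chain_int _ _ _ _).
by apply/funext => w; rewrite big_ord_recl/= addrA.
Qed.

Lemma chain_sq_ge0 m a c x : (0 <= chain_sq m a c x)%E.
Proof.
elim: m a c x => [a c x|m IH a c x]; first by rewrite lee_fin sqr_ge0.
by rewrite chain_sqS; apply: integral_ge0.
Qed.

(** Joint measurability in accumulator and state is what the induction requires, since after one
    step the accumulator depends on the previous state. *)
Lemma measurable_chain_sq2 m c :
  measurable_fun setT (fun z : R * T => chain_sq m z.1 c z.2).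
Proof.
have mg := L2_measurable Lg.
have mcg (k : R) : measurable_fun setT (fun z : R * T => z.1 + k * g z.2).
  apply: measurable_funD; first exact: measurable_fst.
  by apply: measurable_funM => //; apply: measurableT_comp => //; exact: measurable_snd.
elim: m c => [c|m IH c].
  rewrite /chain_sq /=; under eq_fun do rewrite big_ord1.
  by apply/measurable_EFinP; apply: measurable_funX.
under eq_fun do rewrite chain_sqS.
apply: (@measurable_fun_integral_finite_kernel _ _ _ _ R
  (fun zy : R * T * T => chain_sq m (zy.1.1 + c 0%N * g zy.1.2) (c \o S) zy.2)
  (kernel.kernel_snd p)).
  by move=> z; exact: chain_sq_ge0.
apply: (measurableT_comp (IH (c \o S))
  (g := fun zy : R * T * T => (zy.1.1 + c 0%N * g zy.1.2, zy.2))).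
apply/measurable_fun_pair; last exact: measurable_snd.
by apply: (measurableT_comp (mcg (c 0%N))); exact: measurable_fst.
Qed.

Lemma measurable_chain_sq m a c : measurable_fun setT (chain_sq m a c).
Proof.
apply: (measurableT_comp (measurable_chain_sq2 m c) (g := fun x => (a, x))).
exact/measurable_fun_pair.
Qed.

(* conditional mean and second moment of [\sum_i c i * g (w i)] given [w 0] *)
Fixpoint chain_mean m (c : nat -> R) : T -> R :=
  if m is m'.+1 then fun x => c 0%N * g x + P (chain_mean m' (c \o S)) x
  else fun x => c 0%N * g x.

Fixpoint chain_moment m (c : nat -> R) : T -> R :=
  if m is m'.+1 then fun x =>
    (c 0%N * g x) ^+ 2 + 2 * ((c 0%N * g x) * P (chain_mean m' (c \o S)) x)
    + P (chain_moment m' (c \o S)) x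
  else fun x => (c 0%N * g x) ^+ 2.

Lemma L2_chain_mean m c : L2 nu (chain_mean m c).
Proof.
elim: m c => [c|m IH c] /=; first exact: L2_scale.
by apply: L2_add; [exact: L2_scale|case: (L2_markov_op inv (IH (c \o S)))].
Qed.

Lemma integrable_chain_cross m c : nu.-integrable setT
  (EFin \o (fun x => 2 * ((c 0%N * g x) * P (chain_mean m (c \o S)) x))).
Proof.
have [LP _] := L2_markov_op inv (L2_chain_mean m (c \o S)).
have := integrableZl measurableT 2 (L2_integrableM (L2_scale (c 0%N) Lg) LP).
by apply: eq_integrable.
Qed.

Lemma integrable_chain_moment m c : nu.-integrable setT (EFin \o chain_moment m c).
Proof.
elim: m c => [c|m IH c]; first exact/L2_integrable_sqr/L2_scale.
have [PV _] := integral_markov_op inv (IH (c \o S)).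
have := integrableD measurableT (integrableD measurableT
  (L2_integrable_sqr (L2_scale (c 0%N) Lg)) (integrable_chain_cross m c)) PV.
by apply: eq_integrable.
Qed.

(** The square is expanded as a quadratic polynomial in [a]. The quantifier over [a] stands inside
    the almost-everywhere statement because the induction evaluates it at an accumulator depending
    on [x]. *)
Lemma chain_sqE m c : {ae nu, forall x, forall a,
  chain_sq m a c x = (a ^+ 2 + 2 * a * chain_mean m c x + chain_moment m c x)%:E}.
Proof.
elim: m c => [c|m IH c].
  by apply: aeW => x a; rewrite /chain_sq/= big_ord1; congr EFin; ring.
have LU := L2_chain_mean m (c \o S).
near=> x => a.
have Ui : (p x).-integrable setT (EFin \o chain_mean m (c \o S)).
  by near: x; exact: (integrable_kernel inv (L2_integrable LU)).
have Vi : (p x).-integrable setT (EFin \o chain_moment m (c \o S)).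
  by near: x; exact: (integrable_kernel inv (integrable_chain_moment m (c \o S))).
(* The exceptional set of the induction hypothesis is [nu]-null, hence [p x]-null for almost every
   [x]. *)
have IHx : {ae p x, forall y, forall a, chain_sq m a (c \o S) y =
    (a ^+ 2 + 2 * a * chain_mean m (c \o S) y + chain_moment m (c \o S) y)%:E}.
  by near: x; exact: (ae_invariant inv (IH (c \o S))).
rewrite chain_sqS; set b := a + c 0%N * g x.
have bi : (p x).-integrable setT (EFin \o cst (b ^+ 2)).
  apply/integrableP; split; first exact/measurable_EFinP.
  rewrite (eq_integral (cst `|b ^+ 2|%:E))// integral_cst//.
  by rewrite [X in (_ * X)%E]prob_kernel mule1 ltry.
have bUi : (p x).-integrable setT
    (EFin \o (fun y => 2 * b * chain_mean m (c \o S) y)).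
  by have := integrableZl measurableT (2 * b) Ui; apply: eq_integrable.
have bUi2 : (p x).-integrable setT
    (EFin \o (fun y => b ^+ 2 + 2 * b * chain_mean m (c \o S) y)).
  by have := integrableD measurableT bi bUi; apply: eq_integrable.
have bUVi : (p x).-integrable setT (EFin \o (fun y =>
    b ^+ 2 + 2 * b * chain_mean m (c \o S) y + chain_moment m (c \o S) y)).
  by have := integrableD measurableT bUi2 Vi; apply: eq_integrable.
rewrite (ae_eq_integral (fun y => (b ^+ 2 + 2 * b * chain_mean m (c \o S) y
    + chain_moment m (c \o S) y)%:E))//; first last.
- by apply: filterS IHx => y + _.
- by case/integrableP: bUVi.
- exact: measurable_chain_sq.
rewrite -EFin_Rintegral// RintegralD// RintegralD// RintegralZl//.
rewrite Rintegral_cst// prob_kernel/= mulr1; congr EFin.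
by rewrite /b /markov_op; ring.
Unshelve. all: by end_near. Qed.

Variable A : (T -> R) -> (T -> R).
Hypothesis adjA : is_L2_adjoint nu P A.

(** Formally [chain_mean] is the sum of the [c i P^i g]; the identity is proved after pairing with
    [g]. The index [j] counts transitions already collected and grows by one per recursion. *)
Lemma L2inner_iter_chain_mean j m c :
  L2inner nu (iter j P (chain_mean m c)) g =
  \sum_(i < m.+1) c i * L2inner nu (iter (i + j) P g) g.
Proof.
have Lcg := L2_scale (c 0%N) Lg.
have LAj := L2_iter_adjoint adjA j Lg.
elim: m j c Lcg LAj => [j c Lcg LAj|m IH j c Lcg LAj].
  by rewrite big_ord1 (iter_adjoint inv adjA)// L2innerZl// -(iter_adjoint inv adjA).
have LU := L2_chain_mean m (c \o S).
have [LPU _] := L2_markov_op inv LU.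
rewrite (iter_adjoint inv adjA)//; last exact: (L2_chain_mean m.+1).
rewrite [chain_mean m.+1 c]/= L2innerDl// L2innerZl// -!(iter_adjoint inv adjA)//.
rewrite -[iter j P (P _)](iterSr j).
rewrite (IH _ (c \o S) (L2_scale _ Lg) (L2_iter_adjoint adjA j.+1 Lg)).
by rewrite [RHS]big_ord_recl; congr (_ + _); apply: eq_bigr => i _; rewrite addnS.
Qed.

(** Invariance removes the outer [P] from the last term of [chain_moment], and the cross term turns
    into correlations of [g]. *)
Lemma integral_chain_momentS m c : \int[nu]_x chain_moment m.+1 c x =
  c 0%N ^+ 2 * L2inner nu g g
  + 2 * c 0%N * \sum_(i < m.+1) c i.+1 * L2inner nu (iter i.+1 P g) g
  + \int[nu]_x chain_moment m (c \o S) x.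
Proof.
have Lcg := L2_scale (c 0%N) Lg.
have Vi := integrable_chain_moment m (c \o S).
have [PVi PV] := integral_markov_op inv Vi.
have sqi := L2_integrable_sqr Lcg.
have [LPU _] := L2_markov_op inv (L2_chain_mean m (c \o S)).
rewrite [chain_moment _ _]/= RintegralD//; last first.
  by have := integrableD measurableT sqi (integrable_chain_cross m c); apply: eq_integrable.
rewrite RintegralD//; last exact: integrable_chain_cross.
rewrite RintegralZl//; last exact: L2_integrableM.
congr (_ + _ + _).
- under eq_Rintegral do rewrite exprMn.
  by rewrite RintegralZl//; exact: L2_integrable_sqr.
- rewrite -mulrA; congr (_ * _).
  rewrite -/(L2inner nu (fun x => c 0%N * g x) _) L2innerZl//; congr (_ * _).
  rewrite L2innerC (L2inner_iter_chain_mean 1); apply: eq_bigr => i _.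
  by rewrite addn1.
- by congr fine.
Qed.

(** Each pair of times is charged to the earlier one: the later weight is at most [C], and the
    correlations over all positive lags sum to at most [D] times the squared norm. *)
Lemma integral_chain_moment_le (C D : R) m c : (forall i, 0 <= c i <= C) -> 0 <= D ->
  (forall M, \sum_(i < M) `|L2inner nu (iter i.+1 P g) g| <= D * L2inner nu g g) ->
  \int[nu]_x chain_moment m c x <=
  \sum_(i < m.+1) (c i ^+ 2 + 2 * C * D * c i) * L2inner nu g g.
Proof.
move=> cC D0 hD; have S0 := L2inner_ge0 nu g.
have C0 : 0 <= C by have /andP[] := cC 0%N; exact: le_trans.
elim: m c cC => [c cC|m IH c cC].
  have /andP[c0 _] := cC 0%N.
  rewrite big_ord1/=; under eq_Rintegral do rewrite exprMn.
  rewrite RintegralZl//; last exact: L2_integrable_sqr.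
  rewrite -/(L2inner nu g g) ler_wpM2r// lerDl.
  by rewrite !mulr_ge0.
have /andP[c0 _] := cC 0%N.
rewrite integral_chain_momentS [leRHS]big_ord_recl/=; apply: lerD; last first.
  by apply: (IH (c \o S)) => i; exact: cC.
rewrite [leRHS]mulrDl lerD2l.
have -> : 2 * C * D * c 0%N * L2inner nu g g =
  2 * c 0%N * (C * (D * L2inner nu g g)) by ring.
rewrite ler_wpM2l ?mulr_ge0//.
apply: (@le_trans _ _ (C * \sum_(i < m.+1) `|L2inner nu (iter i.+1 P g) g|)).
  rewrite mulr_sumr; apply: ler_sum => i _.
  have /andP[ci0 ciC] := cC i.+1.
  apply: (le_trans (ler_norm _)); rewrite normrM (ger0_norm ci0).
  exact: ler_wpM2r.
exact: ler_wpM2l.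
Qed.

Lemma integral_chain_sq_le (C D : R) m c : (forall i, 0 <= c i <= C) -> 0 <= D ->
  (forall M, \sum_(i < M) `|L2inner nu (iter i.+1 P g) g| <= D * L2inner nu g g) ->
  (\int[nu]_x chain_sq m 0 c x <=
  (\sum_(i < m.+1) (c i ^+ 2 + 2 * C * D * c i) * L2inner nu g g)%:E)%E.
Proof.
move=> cC D0 hD; have Vi := integrable_chain_moment m c.
rewrite (ae_eq_integral (EFin \o chain_moment m c))//; first last.
- by apply: filterS (chain_sqE m c) => x -> _ /=; rewrite expr0n mulr0 mul0r !add0r.
- by case/integrableP: Vi.
- exact: measurable_chain_sq.
by rewrite -EFin_Rintegral// lee_fin; exact: integral_chain_moment_le.
Qed.

End chain_second_moment.

(** * The coupled kernel is a Markov kernel *)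

Section joint_kernel_markov.
Context (R : realType) (X : completeNormedModType R).
Variables (mupr : probability (borel X) R) (Q pia pib : X -> R).
Hypotheses (Q_cont : continuous Q) (Q_gt0 : forall x, 0 < Q x).
Hypotheses (pia_cont : continuous pia) (pia_gt0 : forall x, 0 < pia x).
Hypotheses (pib_cont : continuous pib) (pib_gt0 : forall x, 0 < pib x).
Hypothesis Q_dens : (\int[mupr]_x (Q x)%:E = 1)%E.
Local Notation XX := (borel X * borel X)%type.

Lemma measurable_borel_continuous (f : X -> R) :
  continuous f -> measurable_fun setT (f : borel X -> R).
Proof.
move=> /continuousP cf; apply: (measurability _ (RGenOpens.measurableE R)).
move=> _ [_ [a [b ->] <-]]; rewrite setTI.
by apply: sub_sigma_algebra; exact/cf/interval_open.
Qed.

(** The pair carries the product of the Borel sigma-algebras, so the ratio is split into continuous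
    factors of one variable each. *)
Lemma measurable_alpha (pi : X -> R) : continuous pi -> (forall x, 0 < pi x) ->
  measurable_fun setT (fun z : XX => alpha pi Q z.1 z.2).
Proof.
move=> pi_cont pi_gt0.
have mV (f : X -> R) : continuous f -> (forall x, 0 < f x) ->
    measurable_fun setT (fun x : borel X => (f x)^-1).
  move=> cf f0; apply: measurable_borel_continuous => x.
  by apply: cvgV; [rewrite gt_eqF|exact: cf].
rewrite /alpha; under eq_fun do rewrite invfM.
apply: measurable_minr => //.
apply: measurable_funM; apply: measurable_funM.
- apply: (measurableT_comp (measurable_borel_continuous pi_cont)).
  exact: measurable_snd.
- apply: (measurableT_comp (measurable_borel_continuous Q_cont)).
  exact: measurable_fst.
- apply: (measurableT_comp (mV _ pi_cont pi_gt0)); exact: measurable_fst.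
- apply: (measurableT_comp (mV _ Q_cont Q_gt0)); exact: measurable_snd.
Qed.

Lemma alpha_le1 (pi : X -> R) t z : alpha pi Q t z <= 1.
Proof. by rewrite /alpha ge_min lexx. Qed.

Lemma alpha_ge0 (pi : X -> R) t z : (forall x, 0 < pi x) -> 0 <= alpha pi Q t z.
Proof.
move=> pi_gt0; rewrite /alpha le_min ler01/=.
by rewrite divr_ge0// mulr_ge0// ltW.
Qed.

Let a (w : XX * borel X) := alpha pia Q w.1.1 w.2.
Let b (w : XX * borel X) := alpha pib Q w.1.2 w.2.

Let ma : measurable_fun setT a.
Proof.
apply: (measurableT_comp (measurable_alpha pia_cont pia_gt0)
  (g := fun w : XX * borel X => (w.1.1, w.2))).
apply/measurable_fun_pair; last exact: measurable_snd.
by apply: (measurableT_comp measurable_fst); exact: measurable_fst.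
Qed.

Let mb : measurable_fun setT b.
Proof.
apply: (measurableT_comp (measurable_alpha pib_cont pib_gt0)
  (g := fun w : XX * borel X => (w.1.2, w.2))).
apply/measurable_fun_pair; last exact: measurable_snd.
by apply: (measurableT_comp measurable_snd); exact: measurable_fst.
Qed.

Let mQ : measurable_fun setT (fun w : XX * borel X => Q w.2).
Proof.
apply: (measurableT_comp (measurable_borel_continuous Q_cont)).
exact: measurable_snd.
Qed.

Let mint (f : XX * borel X -> R) : measurable_fun setT f -> (forall w, 0 <= f w) ->
  measurable_fun setT (fun t => \int[mupr]_z (f (t, z))%:E)%E.
Proof.
move=> mf f0.
apply: (@measurable_fun_fubini_tonelli_F _ _ _ _ R mupr (EFin \o f)).
- exact/measurable_EFinP.
- by move=> w; rewrite lee_fin.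
Qed.

(** Common shape of the three moves: [f] is the acceptance weight and [phi] the state reached. *)
Let mpart (f : XX * borel X -> R) (phi : XX * borel X -> XX) (A : set XX) :
  measurable_fun setT f -> (forall w, 0 <= f w) -> measurable_fun setT phi ->
  measurable A ->
  measurable_fun setT (fun t => \int[mupr]_z (f (t, z) * \1_A (phi (t, z)) * Q z)%:E)%E.
Proof.
move=> mf f0 mphi mA.
apply: (mint (f := fun w => f w * \1_A (phi w) * Q w.2)).
  apply: measurable_funM => //; apply: measurable_funM => //.
  by apply: measurableT_comp mphi.
by move=> w; rewrite !mulr_ge0// ltW.
Qed.

Lemma measurable_joint_kernel (A : set XX) : measurable A ->
  measurable_fun setT (joint_kernel mupr Q pia pib ^~ A).
Proof.
move=> mA.
have m1 : measurable_fun setT (fst : XX * borel X -> XX) by exact: measurable_fst.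
have m2 : measurable_fun setT (snd : XX * borel X -> borel X) by exact: measurable_snd.
have m11 : measurable_fun setT (fun w : XX * borel X => w.1.1).
  by apply: (measurableT_comp measurable_fst).
have m12 : measurable_fun setT (fun w : XX * borel X => w.1.2).
  by apply: (measurableT_comp measurable_snd).
apply: emeasurable_funD; first apply: emeasurable_funD; first apply: emeasurable_funD.
- apply: (mpart (f := fun w => Num.min (a w) (b w)) (phi := fun w => (w.2, w.2))) => //.
  + exact: measurable_minr.
  + by move=> w; rewrite le_min !alpha_ge0.
  + exact/measurable_fun_pair.
- apply: (mpart (f := fun w => Num.max 0 (a w - b w)) (phi := fun w => (w.2, w.1.2))) => //.
  + by apply: measurable_maxr => //; exact: measurable_funB.
  + by move=> w; rewrite le_max lexx.
  + exact/measurable_fun_pair.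
- apply: (mpart (f := fun w => Num.max 0 (b w - a w)) (phi := fun w => (w.1.1, w.2))) => //.
  + by apply: measurable_maxr => //; exact: measurable_funB.
  + by move=> w; rewrite le_max lexx.
  + exact/measurable_fun_pair.
- apply: emeasurable_funM.
    by apply/measurable_EFinP.
  apply: emeasurable_funB => //.
  apply: (mint (f := fun w => Num.max (a w) (b w) * Q w.2)).
    by apply: measurable_funM => //; exact: measurable_maxr.
  by move=> w; rewrite mulr_ge0// ?(ltW (Q_gt0 _))// le_max alpha_ge0.
Qed.

(** Since [min(a, b) + (a - b)^+ + (b - a)^+ = max(a, b)], the three moves have exactly the mass
    that the rejection term subtracts from 1. *)
Lemma joint_kernel_setT (t : XX) : joint_kernel mupr Q pia pib t setT = 1%E.
Proof.
have mat : measurable_fun setT (fun z : borel X => alpha pia Q t.1 z).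
  apply: (measurableT_comp ma (g := fun z => (t, z))).
  exact/measurable_fun_pair.
have mbt : measurable_fun setT (fun z : borel X => alpha pib Q t.2 z).
  apply: (measurableT_comp mb (g := fun z => (t, z))).
  exact/measurable_fun_pair.
have mQ0 := measurable_borel_continuous Q_cont.
have Q0 x := ltW (Q_gt0 x).
rewrite /joint_kernel !indicT/=.
under eq_integral do rewrite mulr1.
under [X in (_ + X + _ + _)%E]eq_integral do rewrite mulr1.
under [X in (_ + X + _)%E]eq_integral do rewrite mulr1.
have mM : measurable_fun setT (fun z : borel X =>
    (Num.max (alpha pia Q t.1 z) (alpha pib Q t.2 z) * Q z)%:E).
  by apply/measurable_EFinP; apply: measurable_funM => //; exact: measurable_maxr.
have M0 (z : borel X) : (0 <=
    (Num.max (alpha pia Q t.1 z) (alpha pib Q t.2 z) * Q z)%:E)%E.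
  by rewrite lee_fin mulr_ge0// le_max alpha_ge0.
(* Finiteness, needed for the cancellation in the extended reals, comes from [alpha <= 1] and the
   unit mass of [Q]. *)
have Mfin : (\int[mupr]_z (Num.max (alpha pia Q t.1 z) (alpha pib Q t.2 z) * Q z)%:E)%E
    \is a fin_num.
  rewrite ge0_fin_numE; last exact: integral_ge0.
  apply: (@le_lt_trans _ _ 1%E); last exact: ltry.
  rewrite -Q_dens; apply: ge0_le_integral => //.
  - exact/measurable_EFinP.
  - by move=> z _; rewrite lee_fin ler_piMl// ge_max !alpha_le1.
pose f1 (z : borel X) := (Num.min (alpha pia Q t.1 z) (alpha pib Q t.2 z) * Q z)%:E.
pose f2 (z : borel X) := (Num.max 0 (alpha pia Q t.1 z - alpha pib Q t.2 z) * Q z)%:E.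
pose f3 (z : borel X) := (Num.max 0 (alpha pib Q t.2 z - alpha pia Q t.1 z) * Q z)%:E.
have f10 z : (0 <= f1 z)%E by rewrite lee_fin mulr_ge0// le_min !alpha_ge0.
have f20 z : (0 <= f2 z)%E by rewrite lee_fin mulr_ge0// le_max lexx.
have f30 z : (0 <= f3 z)%E by rewrite lee_fin mulr_ge0// le_max lexx.
have mf1 : measurable_fun setT f1.
  by apply/measurable_EFinP; apply: measurable_funM => //; exact: measurable_minr.
have mf2 : measurable_fun setT f2.
  apply/measurable_EFinP; apply: measurable_funM => //; apply: measurable_maxr => //.
  exact: measurable_funB.
have mf3 : measurable_fun setT f3.
  apply/measurable_EFinP; apply: measurable_funM => //; apply: measurable_maxr => //.
  exact: measurable_funB.
rewrite -/(integral _ _ f1) -/(integral _ _ f2) -/(integral _ _ f3).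
rewrite -(ge0_integralD _ _ _ mf1 _ mf2)// -(ge0_integralD _ _ _ _ _ mf3)//; last first.
- exact: emeasurable_funD.
- by move=> z _; exact: adde_ge0.
rewrite mul1e (eq_integral (fun z : borel X =>
    (Num.max (alpha pia Q t.1 z) (alpha pib Q t.2 z) * Q z)%:E)).
  by rewrite addeCA subee// adde0.
move=> z _; rewrite /f1 /f2 /f3 -!EFinD -!mulrDl; congr (_ * _)%:E.
have [ab|/ltW ba] := leP (alpha pia Q t.1 z) (alpha pib Q t.2 z).
  by rewrite max_l ?subr_le0// max_r ?subr_ge0//; ring.
by rewrite max_r ?subr_ge0// max_l ?subr_le0//; ring.
Qed.

End joint_kernel_markov.

(** * Mean square error of an abstract chain after burn-in *)

Lemma sum_ord_window (R : nmodType) nb N (G : nat -> R) :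
  \sum_(i < (nb + N).+1) (if (nb < i)%N then G i else 0) =
  \sum_(1 <= n < N.+1) G (n + nb)%N.
Proof.
rewrite -(big_mkord xpredT (fun i => if (nb < i)%N then G i else 0)).
(* Index 0 is the starting state, so [nb.+1] indices precede the averaging window; the rest is
   reindexed by [i = n + nb]. *)
rewrite (@big_cat_nat _ _ _ nb.+1) ?ltnS ?leq_addr//=.
rewrite big_nat_cond big1 ?add0r; last first.
  by move=> i /andP[/andP[_ inb] _]; rewrite ltnNge -ltnS inb.
rewrite -[in LHS](add1n nb) big_addn -addnS addKn.
apply: eq_big_nat => n /andP[n0 _].
by rewrite -[X in (X < _)%N]add0n ltn_add2r n0.
Qed.

Lemma Lnormy_ae_le d (T : measurableType d) (R : realType) (mu : probability T R)
    (f : T -> R) (k : R) : (Lnorm mu +oo (EFin \o f) <= k%:E)%E ->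
  {ae mu, forall x, `|f x| <= k}.
Proof.
rewrite unlock [X in (0 < X)%E](@probability_setT _ _ _ mu) lte01 => /ess_supP.
by apply: filterS => x /=; rewrite lee_fin.
Qed.

Section markov_chain_mse.
Context d (T : measurableType d) (R : realType).
Variables (nu : probability T R) (p : R.-pker T ~> T).
Hypothesis inv : forall B, measurable B -> (\int[nu]_t p t B = nu B)%E.
Local Notation P := (markov_op p).
Variable A : (T -> R) -> (T -> R).
Hypothesis adjA : is_L2_adjoint nu P A.
Variables (N nb : nat).
Hypothesis N_gt0 : (0 < N)%N.

Definition sq_avg (g : T -> R) (w : nat -> T) : \bar R :=
  ((N%:R^-1 * \sum_(1 <= n < N.+1) g (w (n + nb)%N)) ^+ 2)%:E.

(** Weights that write the average after burn-in as a sum over the whole path from [w 0], the form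
    treated by [chain_sq]. *)
Let c i : R := if (nb < i)%N then N%:R^-1 else 0.

Let sq_avgE g : chain_int p (nb + N) (sq_avg g) = chain_sq p g (nb + N) 0 c.
Proof.
rewrite /chain_sq; congr chain_int; apply/funext => w; rewrite /sq_avg add0r.
congr (_ ^+ 2)%:E; rewrite mulr_sumr.
rewrite -(sum_ord_window nb N (fun i => N%:R^-1 * g (w i))).
by apply: eq_bigr => i _; rewrite /c; case: ifP => // _; rewrite mul0r.
Qed.

(** With all weights at most [1/N], each of the [N] indices in the window contributes
    [(1 + 2 D) / N^2] times the squared norm. *)
Lemma stationary_mse_le (g : T -> R) (D : R) : L2 nu g -> 0 <= D ->
  (forall M, \sum_(i < M) `|L2inner nu (iter i.+1 P g) g| <= D * L2inner nu g g) ->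
  (\int[nu]_x chain_int p (nb + N) (sq_avg g) x <=
   ((1 + 2 * D) * (L2inner nu g g / N%:R))%:E)%E.
Proof.
move=> Lg D0 hD; have N0 : 0 < N%:R :> R by rewrite ltr0n.
have cN i : 0 <= c i <= N%:R^-1.
  by rewrite /c; case: ifP; rewrite ?lexx ?invr_ge0 ?ler0n.
rewrite sq_avgE; apply: (le_trans (integral_chain_sq_le inv Lg adjA (nb + N) cN D0 hD)).
rewrite lee_fin -mulr_suml.
rewrite (eq_bigr (fun i : 'I_(nb + N).+1 => if (nb < i)%N then
    N%:R^-1 ^+ 2 + 2 * N%:R^-1 * D * N%:R^-1 else 0)); last first.
  by move=> i _; rewrite /c; case: ifP => // _; rewrite expr0n mulr0 addr0.
rewrite (sum_ord_window nb N (fun=> N%:R^-1 ^+ 2 + 2 * N%:R^-1 * D * N%:R^-1)).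
rewrite big_const_nat subn1/= iter_addr_0 -mulr_natl le_eqVlt; apply/orP; left.
by apply/eqP; field; rewrite gt_eqF.
Qed.

Variables (nu0 : probability T R) (h : T -> R).
Hypotheses (mh : measurable_fun setT h) (h_ge0 : forall t, 0 <= h t).
Hypothesis nu0E : forall B, measurable B -> nu0 B = (\int[nu]_(t in B) (h t)%:E)%E.

Lemma chain_expect_density_le (g : T -> R) (k : R) : L2 nu g -> 0 <= k ->
  {ae nu, forall x, h x <= k} ->
  (chain_expect nu0 p (nb + N) (sq_avg g) <=
   k%:E * \int[nu]_x chain_int p (nb + N) (sq_avg g) x)%E.
Proof.
move=> Lg k0 hk; apply: ge0_integral_le_measure => //.
- move=> B mB; rewrite [leLHS]nu0E// -[leRHS]integral_cst//.
  apply: ae_ge0_le_integral => //.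
  + by move=> x _; rewrite lee_fin.
  + by apply/measurable_EFinP; exact: measurable_funTS.
  + by apply: filterS hk => x hx _; rewrite lee_fin.
- by move=> x; rewrite sq_avgE chain_sq_ge0.
Qed.

Hypothesis h_bounded : (Lnorm nu +oo (EFin \o h) < +oo)%E.

Local Notation Cgap := (Cinv (pseudo_spectral_gap nu P A)).

Lemma markov_chain_mse_le (g : T -> R) : L20 nu g ->
  (chain_expect nu0 p (nb + N) (sq_avg g) <=
   (Cgap + 2%:E * Lnorm nu +oo (EFin \o (fun t => (h t - 1)%R)) * Cgap)
   * (L2inner nu g g / N%:R)%:E)%E.
Proof.
move=> Lg0; have [Lg _] := Lg0.
have N0 : 0 < N%:R :> R by rewrite ltr0n.
(* Zero variance is separate: the right-hand side is then 0 even if the constant is +oo, so the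
   error itself must be shown to vanish. *)
have := L2inner_ge0 nu g; rewrite le_eqVlt => /orP[/eqP V0|V0].
  have hD M : \sum_(i < M) `|L2inner nu (iter i.+1 P g) g| <= 0 * L2inner nu g g.
    rewrite mul0r big1// => i _; apply/eqP; rewrite normr_eq0 -sqrf_eq0 eq_le sqr_ge0 andbT.
    have [LP _] := L2_iter_markov_op inv i.+1 Lg.
    by apply: le_trans (L2inner_cauchy_schwarz LP Lg) _; rewrite -V0 mulr0.
  have := stationary_mse_le Lg (lexx 0) hD.
  rewrite -V0 mul0r !mulr0 mule0 => le0.
  have hfin : Lnorm nu +oo (EFin \o h) \is a fin_num.
    by rewrite ge0_fin_numE// Lnorm_ge0.
  have hk : {ae nu, forall x, h x <= fine (Lnorm nu +oo (EFin \o h))}.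
    have : {ae nu, forall x, `|h x| <= fine (Lnorm nu +oo (EFin \o h))}.
      by apply: Lnormy_ae_le; rewrite fineK.
    by apply: filterS => x; apply: le_trans; exact: ler_norm.
  apply: (le_trans (chain_expect_density_le Lg _ hk)); first exact/fine_ge0/Lnorm_ge0.
  by apply: mule_ge0_le0 => //; rewrite lee_fin fine_ge0// Lnorm_ge0.
have VN : (0 < (L2inner nu g g / N%:R)%:E)%E by rewrite lte_fin divr_gt0.
have := Lnorm_ge0 nu +oo%E (EFin \o (fun t => h t - 1)).
(* A gap outside the open interval from 0 to +oo makes the constant +oo, and the bound is trivial
   for positive variance. *)
rewrite /Cinv; case: ifP => [/andP[gap0 gapy]|_]; last first.
  move=> n0; rewrite addye; last first.
    by rewrite gt_eqF// (@lt_le_trans _ _ 0%E)// !mule_ge0.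
  by rewrite gt0_mulye// leey.
have gapfin : pseudo_spectral_gap nu P A \is a fin_num by rewrite gt0_fin_numE.
move: gap0 gapy; rewrite -(fineK gapfin); set gamma := fine _.
rewrite lte_fin /= => gamma0 _.
have C0 : 0 < 1 + 4 / gamma by rewrite addr_gt0// divr_gt0.
(* An infinite norm of [h - 1] makes the right-hand side +oo as well. *)
case E : (Lnorm nu +oo _) => [k| |//] k0; last first.
  rewrite gt0_muley ?lte_fin// gt0_mulye ?lte_fin// addey//.
  by rewrite gt0_mulye// leey.
rewrite lee_fin in k0.
have hk : {ae nu, forall x, h x <= 1 + k}.
  have : {ae nu, forall x, `|h x - 1| <= k} by apply: Lnormy_ae_le; rewrite E.
  by apply: filterS => x hx; rewrite -lerBlDl; apply: le_trans hx; exact: ler_norm.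
have D0 : 0 <= 2 / gamma by rewrite divr_ge0// ltW.
(* the supremum defining the gap need not be attained; the slack between
   [1 + 2 * (2 / gamma - 1)] and [1 + 4 / gamma] absorbs the loss *)
have hD M : \sum_(i < M) `|L2inner nu (iter i.+1 P g) g| <= 2 / gamma * L2inner nu g g.
  (* Chosen to solve [2 / gamma' = 2 / gamma + 1]; the extra 1 is cancelled by the correlation at
     lag zero, which is the squared norm of [g]. *)
  pose gamma' := 2 * gamma / (gamma + 2).
  have g20 : 0 < gamma + 2 by rewrite addr_gt0.
  have g'0 : 0 < gamma' by rewrite divr_gt0// mulr_gt0.
  have g'g : (gamma'%:E < pseudo_spectral_gap nu P A)%E.
    by rewrite -(fineK gapfin) lte_fin -/gamma ltr_pdivrMr//; nra.
  have := sum_correlation_le inv adjA M.+1 g'0 g'g Lg0.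
  rewrite big_ord_recl /= ger0_norm ?L2inner_ge0//.
  have -> : 2 / gamma' = 2 / gamma + 1.
    by rewrite /gamma'; field; rewrite !gt_eqF.
  by rewrite mulrDl mul1r addrC lerD2r.
have k10 : 0 <= 1 + k by rewrite addr_ge0.
apply: (le_trans (chain_expect_density_le Lg k10 hk)).
apply: (le_trans (lee_wpmul2l _ (stationary_mse_le Lg D0 hD))).
  by rewrite lee_fin.
rewrite -!EFinM lee_fin [leLHS]mulrA ler_wpM2r//.
  by rewrite divr_ge0// ltW.
have -> : 2 * (2 / gamma) = 4 / gamma by field; rewrite gt_eqF.
(* The stationary bound is multiplied by [1 + k], and [k] is at most the [2 * k] of the
   nonstationary constant. *)
by rewrite mulrDl mul1r lerD2l ler_wpM2r ?(ltW C0)// ler_peMl// ler1n.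
Qed.

End markov_chain_mse.

(** * Application to the coupled kernel at level [l] *)

Unset Implicit Arguments.

Theorem mainTheorem8 (R : realType) (X : completeNormedModType R)
  (* X is separable *)
  (hsep : exists D : set X, countable D /\ closure D = setT)
  (* prior *)
  (mupr : probability (borel X) R)
  (* number of levels, posterior densities pi_j (j = 0..L) and proposal
     densities Q_l (l = 1..L), all w.r.t. the prior *)
  (L : nat) (pi : nat -> X -> R) (Q : nat -> X -> R)
  (hpi_dens : forall j, (j <= L)%N -> (\int[mupr]_x (pi j x)%:E = 1)%E)
  (hQ_dens : forall l, (1 <= l <= L)%N -> (\int[mupr]_x (Q l x)%:E = 1)%E)
  (* Assumption 1 *)
  (A11 : forall l, (1 <= l <= L)%N -> continuous (Q l) /\ forall x, 0 < Q l x)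
  (A12 : forall j, (j <= L)%N -> continuous (pi j) /\ forall x, 0 < pi j x)
  (A13 : forall l, (1 <= l <= L)%N -> forall j, (j == l.-1) || (j == l) ->
          forall cr : R, 0 < cr -> compact [set t : X | Q l t / pi j t <= cr])
  (A14 : exists c : R, 0 < c < 1 /\
          forall l, (1 <= l <= L)%N -> forall j, (j == l.-1) || (j == l) ->
          (c%:E <= ess_inf mupr (fun z : borel X => (Q l z / pi j z)%:E))%E)
  (A15 : exists r Cr : R, 1 < r /\
          forall l, (1 <= l <= L)%N -> (\int[mupr]_z ((Q l z) `^ r)%:E <= Cr%:E)%E)
  (* the level l, its joint kernel p_l, invariant measure nu_l, adjoint P_l^* *)
  (l : nat) (hl : (1 <= l <= L)%N)
  (p : (borel X * borel X)%type -> {measure set (borel X * borel X)%type -> \bar R})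
  (hp : forall t A, measurable A ->
          p t A = joint_kernel mupr (Q l) (pi l.-1) (pi l) t A)
  (nu : probability (borel X * borel X)%type R)
  (hnu : forall A, measurable A -> (\int[nu]_t p t A = nu A)%E)
  (Pstar : ((borel X * borel X)%type -> R) -> ((borel X * borel X)%type -> R))
  (hPstar : is_L2_adjoint nu (markov_op p) Pstar)
  (* the quantity of interest *)
  (Y : (borel X * borel X)%type -> R) (hY : L2 nu Y)
  (* initial distribution nu0 << nu with density h in L_infty(nu) *)
  (nu0 : probability (borel X * borel X)%type R)
  (h : (borel X * borel X)%type -> R) (hh : measurable_fun setT h)
  (hh0 : forall t, 0 <= h t)
  (hnu0 : forall A, measurable A -> nu0 A = (\int[nu]_(t in A) (h t)%:E)%E)
  (hhinf : (Lnorm nu +oo (EFin \o h) < +oo)%E)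
  (N nb : nat) (hN : (0 < N)%N) :
  let g := fun t => Y t - Rintegral nu setT Y in
  let gps := pseudo_spectral_gap nu (markov_op p) Pstar in
  let Cmse := (Cinv gps
               + 2%:E * Lnorm nu +oo (EFin \o (fun t => (h t - 1)%R)) * Cinv gps)%E in
  (chain_expect nu0 p (nb + N)
     (fun w => ((N%:R^-1 * \sum_(1 <= n < N.+1) g (w (n + nb)%N)) ^+ 2)%:E)
   <= Cmse * ((Rintegral nu setT (fun t => (Y t - Rintegral nu setT Y) ^+ 2))
              / N%:R)%:E)%E.
Proof.
have [Q_cont Q_gt0] := A11 l hl.
have /andP[l1 lL] := hl.
have [pa_cont pa_gt0] := A12 l.-1 (leq_trans (leq_pred l) lL).
have [pb_cont pb_gt0] := A12 l lL.
(* [hp] transfers measurability in the starting state and unit mass from the explicit kernel to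
   [p]. *)
have kernel_p U : measurable U -> measurable_fun setT (p ^~ U).
  move=> mU; rewrite (_ : p ^~ U = joint_kernel mupr (Q l) (pi l.-1) (pi l) ^~ U).
    exact: measurable_joint_kernel.
  by apply/funext => t; exact: hp.
have prob_p t : p t setT = 1%E.
  by rewrite hp//; apply: joint_kernel_setT => //; exact: hQ_dens.
(* [p] is packed as a probability kernel with the same underlying function, so the hypotheses on [p]
   apply to [pk] by conversion. *)
pose pK := isKernel.Build _ _ _ _ _ p kernel_p.
pose pkK : R.-ker (borel X * borel X)%type ~> (borel X * borel X)%type :=
  HB.pack p pK.
pose pP := Kernel_isProbability.Build _ _ _ _ _ pkK prob_p.
pose pk : R.-pker (borel X * borel X)%type ~> (borel X * borel X)%type :=
  HB.pack p pK pP.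
exact: (@markov_chain_mse_le _ _ R nu pk hnu Pstar hPstar N nb hN nu0 h hh hh0
  hnu0 hhinf _ (L20_center hY)).
Qed.
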